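(* Let $n\ge 1$ be an integer, and let $p,\alpha,\lambda$ be real numbers such that either ($p>1$ and $0<\alpha<\frac{n+2}{2p}$) or ($p=1$ and $0<\alpha\le\frac{n+2}{2p}$), and such that $\lambda>1$ and $0<\alpha<\frac{n+2}{2p}\left(1-\frac1\lambda\right)$. Let $q\in(p,\infty]$. Then there exist $u\in Y^p_\alpha$ satisfying $$0\le(\partial_t-\Delta)^\alpha u\le u^\lambda\quad\text{in }\mathbb{R}^n\times\mathbb{R},\qquad u=0\quad\text{in }\mathbb{R}^n\times(-\infty,0)$$ and a sequence $\{t_j\}\subset(0,1)$ such that $$\lim_{j\to\infty}t_j=0$$ and $$\|u^\lambda\|_{L^q(R_j)}=\|(\partial_t-\Delta)^\alpha u\|_{L^q(R_j)}=\infty\quad\text{for }j=1,2,\ldots,$$ where $$R_j=\{(x,t)\in\mathbb{R}^n\times\mathbb{R}:|x|<\sqrt{t_j}\text{ and }t_j<t<2t_j\}.$$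
   Context: For $\alpha>0$ and $(x,t)\in\mathbb{R}^n\times\mathbb{R}$ let $$\Phi_\alpha(x,t)=\frac{t^{\alpha-1}}{\Gamma(\alpha)}\frac{1}{(4\pi t)^{n/2}}e^{-|x|^2/(4t)}\chi_{(0,\infty)}(t)$$ and $$J_\alpha f(x,t)=\iint_{\mathbb{R}^n\times(-\infty,t)}\Phi_\alpha(x-\xi,t-\tau)f(\xi,\tau)\,d\xi\,d\tau .$$ For $T\in\mathbb{R}$ put $\mathbb{R}_T=(-\infty,T)$. $X^p=\bigcap_{T\in\mathbb{R}}L^p(\mathbb{R}^n\times\mathbb{R}_T)$ is the set of all measurable $f:\mathbb{R}^n\times\mathbb{R}\to\mathbb{R}$ with $\|f\|_{L^p(\mathbb{R}^n\times\mathbb{R}_T)}<\infty$ for all $T\in\mathbb{R}$, and $Y^p_\alpha=J_\alpha(X^p)$. Functions equal almost everywhere are identified, and (in)equalities between elements of these spaces are understood almost everywhere. When ($p>1$ and $0<\alpha<\frac{n+2}{2p}$) or ($p=1$ and $0<\alpha\le\frac{n+2}{2p}$), the integral defining $J_\alpha f$ yields a real-valued measurable function for each $f\in X^p$, the operator $J_\alpha:X^p\to Y^p_\alpha$ is one-to-one and onto, and $(\partial_t-\Delta)^\alpha:Y^p_\alpha\to X^p$ is defined to be its inverse. Since $(\partial_t-\Delta)^\alpha u\ge0$ forces $u\ge0$, the power $u^\lambda$ is meaningful. *)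

(* Defs.v *)
From HB Require Import structures.
From mathcomp Require Import all_boot all_order all_algebra.
From mathcomp Require Import all_classical all_reals all_analysis.

Set Implicit Arguments.
Unset Strict Implicit.
Unset Printing Implicit Defensive.

Import Order.TTheory GRing.Theory Num.Theory.
Import numFieldNormedType.Exports.

Local Open Scope classical_set_scope.
Local Open Scope ring_scope.

(* R^n is the type of n-tuples; its product sigma-algebra is the Borel
   sigma-algebra, so "measurable" means Borel measurable.  As functions are
   considered up to almost everywhere equality, this loses nothing with respect
   to Lebesgue measurability. *)
Notation Rn R n := (n.-tuple (measurableTypeR R)).

(* Space-time R^n x R: a point z is (x, t) = (z.1, z.2). *)
Notation RnR R n := (Rn R n * measurableTypeR R)%type.

Lemma product_sigma_finite d1 d2 (T1 : measurableType d1)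
    (T2 : measurableType d2) (R : realType)
    (m1 : {sigma_finite_measure set T1 -> \bar R})
    (m2 : {sigma_finite_measure set T2 -> \bar R}) :
  sigma_finite setT (m1 \x m2)%E.
Proof.
have /sigma_finiteP[F [TF ndF Foo]] := sigma_finiteT m1.
have /sigma_finiteP[G [TG ndG Goo]] := sigma_finiteT m2.
exists (fun n => F n `*` G n).
  rewrite -setXTT TF TG predeqE => -[x y]; split.
    move=> [/= [n _ Fnx] [k _ Gky]]; exists (maxn n k) => //; split.
    - by move: x Fnx; exact/subsetPset/ndF/leq_maxl.
    - by move: y Gky; exact/subsetPset/ndG/leq_maxr.
  by move=> [n _ []/= ? ?]; split; exists n.
move=> k; have [? ?] := Foo k; have [? ?] := Goo k.
split; first exact: measurableX.
by rewrite product_measure1E// lte_mul_pinfty// ge0_fin_numE.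
Qed.

Section lebesgue_measure_Rn.
Context {R : realType}.
Local Open Scope ereal_scope.

Definition cons_Rn n (z : RnR R n) : Rn R n.+1 :=
  [the n.+1.-tuple (measurableTypeR R) of z.2 :: z.1].

Definition uncons_Rn n (x : Rn R n.+1) : RnR R n :=
  ([tuple of behead x], thead x).

Lemma cons_RnK n : cancel (@cons_Rn n) (@uncons_Rn n).
Proof. by case=> x t; congr (_, _); exact/val_inj. Qed.

Lemma measurable_cons_Rn n : measurable_fun [set: RnR R n] (@cons_Rn n).
Proof. exact: measurable_cons. Qed.

Lemma measurable_uncons_Rn n : measurable_fun [set: Rn R n.+1] (@uncons_Rn n).
Proof.
apply/measurable_fun_pairP; split; first exact: measurable_behead.
exact: measurable_tnth.
Qed.

Section step.
Context n (m : {sigma_finite_measure set (Rn R n) -> \bar R}).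

Definition cons_measure : set (Rn R n.+1) -> \bar R :=
  pushforward (m \x lebesgue_measure) (@cons_Rn n).

Let mc := @measurable_cons_Rn n.

Let cons_measure0 : cons_measure set0 = 0.
Proof. exact: measure0. Qed.

Let cons_measure_ge0 A : 0 <= cons_measure A.
Proof. exact: measure_ge0. Qed.

Let cons_measure_sigma_additive : semi_sigma_additive cons_measure.
Proof. exact: measure_semi_sigma_additive. Qed.

HB.instance Definition _ := isMeasure.Build _ _ _ cons_measure
  cons_measure0 cons_measure_ge0 cons_measure_sigma_additive.

Let cons_measure_sigma_finite : sigma_finite setT cons_measure.
Proof.
have [F FT Ffin] := product_sigma_finite m (@lebesgue_measure R).
exists (fun i => @uncons_Rn n @^-1` F i).
  by rewrite -preimage_bigcup -FT preimage_setT.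
move=> i; have [mF Foo] := Ffin i; split.
  by rewrite -[X in measurable X]setTI; exact: measurable_uncons_Rn.
rewrite /cons_measure /pushforward (_ : _ @^-1` _ = F i)//.
by apply/seteqP; split => z /=; rewrite cons_RnK.
Qed.

HB.instance Definition _ := Measure_isSigmaFinite.Build _ _ _ cons_measure
  cons_measure_sigma_finite.

End step.

(* n-dimensional Lebesgue measure, i.e. the n-fold product of the Lebesgue
   measure on R transported to n-tuples. *)
Fixpoint lebesgue_Rn n : {sigma_finite_measure set (Rn R n) -> \bar R} :=
  match n with
  | 0 => dirac ([tuple] : Rn R 0)
  | k.+1 => cons_measure (lebesgue_Rn k)
  end.

Lemma lebesgue_Rn_box n (A : 'I_n -> set (measurableTypeR R)) :
  (forall i, measurable (A i)) ->
  lebesgue_Rn n [set x | forall i, A i (tnth x i)] =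
  \prod_(i < n) lebesgue_measure (A i).
Proof.
elim: n A => [|n ih] A mA.
  rewrite big_ord0 /= diracE mem_set//=; by case.
rewrite big_ord_recl /= /cons_measure /pushforward.
rewrite (_ : _ @^-1` _ =
    [set x | forall i, A (lift ord0 i) (tnth x i)] `*` A ord0).
  have mB : measurable
      [set x : Rn R n | forall i, A (lift ord0 i) (tnth x i)].
    rewrite (_ : [set x | _] = \bigcap_(i in [set: 'I_n])
        ((fun x : Rn R n => tnth x i) @^-1` A (lift ord0 i))); last first.
      by apply/seteqP; split => x /= h i; [move=> _|]; exact: h.
    apply: fin_bigcap_measurable => // i _.
    by rewrite -[X in measurable X]setTI; exact: measurable_tnth.
  by rewrite product_measure1E// muleC; congr (_ * _); exact: ih.
apply/seteqP; split => -[x t] /=.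
  move=> h; split; last exact: (h ord0).
  by move=> i; have := h (lift ord0 i); rewrite tnthS.
by move=> [h h0] i; case: (unliftP ord0 i) => [j ->|->//]; rewrite tnthS.
Qed.

Section lebesgue_RnR.
Context {n : nat}.

Definition lebesgue_RnR : set (RnR R n) -> \bar R :=
  lebesgue_Rn n \x lebesgue_measure.

HB.instance Definition _ := Measure.on lebesgue_RnR.

HB.instance Definition _ := Measure_isSigmaFinite.Build _ _ _ lebesgue_RnR
  (product_sigma_finite (lebesgue_Rn n) (@lebesgue_measure R)).

End lebesgue_RnR.

End lebesgue_measure_Rn.

Section heat_potentials.
Context {R : realType} {n : nat}.
Implicit Types (p alpha : R) (u f : RnR R n -> R).

Definition sub_Rn (x y : Rn R n) : Rn R n :=
  [tuple (tnth x i : R) - tnth y i | i < n].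

Definition norm_Rn (x : Rn R n) : R :=
  Num.sqrt (\sum_(i < n) (tnth x i : R) ^+ 2).

Definition Gamma (a : R) : R :=
  \int[lebesgue_measure]_(s in `]0, +oo[) (s `^ (a - 1) * expR (- s)).

Definition Phi alpha (x : Rn R n) (t : R) : R :=
  if 0 < t then
    t `^ (alpha - 1) / Gamma alpha
    * (1 / (4 * pi * t) `^ (n%:R / 2))
    * expR (- (norm_Rn x ^+ 2 / (4 * t)))
  else 0.

(* The integral is [fine]d: the value is irrelevant at the points, which form
   a null set for f in X^p, where it is not a real number. *)
Definition J alpha f (z : RnR R n) : R :=
  \int[lebesgue_RnR]_(w in [set: Rn R n] `*` `]-oo, (z.2 : R)[)
    (Phi alpha (sub_Rn z.1 w.1) ((z.2 : R) - w.2) * f w).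

(* || f ||_{L^q(D)}, as an extended real; q may be infinite. *)
Definition Lnorm_on (D : set (RnR R n)) (q : \bar R) f : \bar R :=
  'N[lebesgue_RnR]_q[EFin \o (f \_ D)]%E.

Definition Xspace p : set (RnR R n -> R) :=
  [set f | measurable_fun [set: RnR R n] f /\
    forall T : R, (Lnorm_on ([set: Rn R n] `*` `]-oo, T[) p%:E f < +oo)%E].

(* Elements of X^p and Y^p_alpha are functions modulo almost everywhere
   equality. *)
Definition Yspace p alpha : set (RnR R n -> R) :=
  [set u | measurable_fun [set: RnR R n] u /\
    exists2 f, Xspace p f & u = J alpha f %[ae lebesgue_RnR]].

(* [is_heat_power p alpha u f] means f = (d/dt - Laplacian)^alpha u.  As
   (d/dt - Laplacian)^alpha : Y^p_alpha -> X^p is the inverse of the bijection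
   J_alpha : X^p -> Y^p_alpha, its graph consists of the pairs (u, f) with
   f in X^p and J_alpha f = u. *)
Definition is_heat_power p alpha u f : Prop :=
  [/\ Yspace p alpha u, Xspace p f & J alpha f = u %[ae lebesgue_RnR]].

(* The parabolic cylinder |x| < sqrt s, s < t < 2 s *)
Definition cylinder (s : R) : set (RnR R n) :=
  [set z | norm_Rn z.1 < Num.sqrt s /\ s < (z.2 : R) < 2 * s].

End heat_potentials.

(* Main.v *)
Require Import Defs.
From HB Require Import structures.
From mathcomp Require Import all_boot all_order all_algebra.
From mathcomp Require Import all_classical all_reals all_analysis.
From mathcomp Require Import measurable_realfun ess_sup_inf ring lra.
Import Order.TTheory GRing.Theory Num.Theory.
Import numFieldNormedType.Exports.
Local Open Scope classical_set_scope.
Local Open Scope ring_scope.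

(** The source term f is a sum of countably many point singularities.  Put b
    strictly between max(alpha lambda / (lambda - 1), (n+2) / (2q)) and
    (n+2) / (2p), where (n+2) / (2q) is 0 for infinite q; the hypotheses on
    alpha and q say that this interval is not empty.  In the parabolic cell
    {s < t < s + d, 0 < x_i < sqrt (t - s) for all i} with vertex (0, s) let f
    be (t - s)^(-b).  The slice of the cell at time t has volume
    (t - s)^(n/2), so f^r is integrable on the cell when b r < n/2 + 1, with
    integral O(d^(n/2 + 1 - b r)): this holds for r = p, while f is not in L^q
    there ([Lnorm_on_cell_infinite]).  Parabolic scaling makes J_alpha f at
    least c (t - s)^(alpha - b) on the cell, because the part of the cell lying
    between a quarter and a half of the elapsed time t - s already contributes
    that much ([potential_ge_on_cell]).  Hence
    u^lambda >= c^lambda (t - s)^(-theta) (t - s)^(-b) with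
    theta = (b - alpha) lambda - b > 0, and this dominates f as soon as d is
    small.  The positivity of the kernel is essential here: further
    singularities only increase u, so that each cell takes care of itself.

    With vertices (0, t_j), t_j = 2^-(j+1), and heights proportional to t_j, the cells are
    disjoint, the j-th one lies in the cylinder R_j, and the integrals of f^p
    over the cells form a convergent geometric series
    ([integral_source_powR_lty]).

    The value of J_alpha f at a point where the integral diverges carries no
    information, so the inequality f <= u^lambda also needs that the potential
    is finite almost everywhere.  This follows from Tonelli's theorem
    ([ae_potential_lty]): the heat kernel at a fixed time is a product of
    normal densities, hence has mass 1, and t^(alpha - 1) is integrable near 0,
    so the potential of an integrable f is integrable over bounded time
    intervals. *)

(** * Integrals of powers, the Gamma function, geometric series *)

Section power_integrals.
Context {R : realType}.
Implicit Types a b k : R.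

Lemma measurable_powR_shift a k (D : set R) :
  measurable_fun D (fun t : R => (t - a) `^ k).
Proof.
apply: measurable_funTS.
apply: (measurableT_comp (measurable_powR k)).
exact: measurable_funB.
Qed.

Lemma is_derive_powR_shift a k (t : R) : a < t ->
  is_derive t 1 (fun t : R => (t - a) `^ k) (k * (t - a) `^ (k - 1)).
Proof.
move=> at_.
have -> : k * (t - a) `^ (k - 1) = k * (t - a) `^ (k - 1) * 1 by rewrite mulr1.
apply: (@is_derive1_comp _ (fun x => x `^ k) (fun t => t - a)).
  by apply: is_derive1_powR; rewrite subr_gt0.
by apply: is_derive_eq; rewrite subr0.
Qed.

Lemma continuous_powR_shift a k (t : R) : a < t ->
  {for t, continuous (fun t : R => (t - a) `^ k)}.
Proof.
move=> at_; apply: differentiable_continuous; apply/derivable1_diffP.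
by have [] := is_derive_powR_shift a k t at_.
Qed.

(** The integrand may be unbounded at a, so the fundamental theorem of calculus
    is applied on [a + e, b] and e tends to 0 by monotone convergence. *)
Lemma integral_powR_shift_le a b k : 0 < k -> a < b ->
  (\int[lebesgue_measure]_(t in `]a, b[) ((t - a) `^ (k - 1))%:E
    <= ((b - a) `^ k / k)%:E)%E.
Proof.
move=> k0 ab.
(* the denominator n + 2 keeps the left end point strictly below b *)
pose G n := `[a + (b - a) / n.+2%:R, b]%classic : set R.
pose F (t : R) := k^-1 * (t - a) `^ k.
have dF t : a < t -> is_derive t 1 F ((t - a) `^ (k - 1)).
  move=> at_; have h := is_deriveZ k^-1 (is_derive_powR_shift a k t at_).
  by apply: is_derive_eq; rewrite scalerA mulVf ?scale1r// gt_eqF.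
have cF t : a < t -> {for t, continuous F}.
  move=> at_; apply: differentiable_continuous; apply/derivable1_diffP.
  by have [] := dF t at_.
have e0 n : 0 < (b - a) / n.+2%:R by rewrite divr_gt0// subr_gt0.
have lt_b n : a + (b - a) / n.+2%:R < b.
  rewrite -ltrBrDl ltr_pdivrMr// ltr_pMr ?subr_gt0//.
  by rewrite ltr1n.
have intG n : (\int[lebesgue_measure]_(t in G n) ((t - a) `^ (k - 1))%:E
    <= ((b - a) `^ k / k)%:E)%E.
  rewrite /G (@continuous_FTC2 _ _ F)//.
  - rewrite -EFinB lee_fin /F mulrC lerBlDr lerDl.
    by rewrite mulr_ge0 ?powR_ge0// invr_ge0 ltW.
  - apply: continuous_in_subspaceT => t; rewrite inE/= in_itv/= => /andP[h _].
    by apply: continuous_powR_shift; rewrite (lt_le_trans _ h)// ltrDl.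
  - split.
    + move=> t; rewrite in_itv/= => /andP[h _].
      by have [] := dF t _; first rewrite (lt_trans _ h)// ltrDl.
    + by apply: cvg_at_right_filter; apply: cF; rewrite ltrDl.
    + by apply: cvg_at_left_filter; apply: cF.
  - move=> t; rewrite in_itv/= => /andP[h _]; rewrite derive1E.
    by have [] := dF t _; first rewrite (lt_trans _ h)// ltrDl.
have sub : `]a, b[%classic `<=` \bigcup_i G i.
  move=> t /=; rewrite in_itv/= => /andP[at_ tb].
  pose N := Num.truncn ((b - a) / (t - a)).
  exists N => //; rewrite /G/= in_itv/= (ltW tb) andbT -lerBrDl.
  rewrite ler_pdivrMr// mulrC -ler_pdivrMr ?subr_gt0//.
  apply/ltW/(lt_trans (truncnS_gt _)).
  by rewrite ltr_nat.
have mG i : measurable (G i) by exact: measurable_itv.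
have mf (D : set R) : measurable_fun D (fun t => ((t - a) `^ (k - 1))%:E).
  by apply/measurable_EFinP; exact: measurable_powR_shift.
apply: (@le_trans _ _ (\int[lebesgue_measure]_(t in \bigcup_i G i)
    ((t - a) `^ (k - 1))%:E)%E).
  apply: ge0_subset_integral => //.
  - by apply: bigcup_measurable => i _; exact: mG.
  - exact: mf.
  - by move=> x _; rewrite lee_fin powR_ge0.
have nd : {homo G : n m / (n <= m)%N >-> (n <= m)%O}.
  move=> n m nm; apply/subsetPset => t; rewrite /G/= !in_itv/= => /andP[h ->].
  rewrite andbT (le_trans _ h)// lerD2l ler_pM2l ?subr_gt0//.
  by rewrite lef_pV2 ?posrE// ler_nat !ltnS.
have cvgG : (\int[lebesgue_measure]_(t in G i) ((t - a) `^ (k - 1))%:E)%E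
    @[i --> \oo] -->
    (\int[lebesgue_measure]_(t in \bigcup_i G i) ((t - a) `^ (k - 1))%:E)%E.
  apply: ge0_nondecreasing_set_cvg_integral => //.
    by move=> i; exact: mf.
  by move=> i x _; rewrite lee_fin powR_ge0.
move/cvg_lim : (cvgG) => <-//.
apply: lime_le; first by apply/cvg_ex; eexists; exact: cvgG.
by apply: nearW.
Qed.

End power_integrals.

Section Gamma_positive.
Context {R : realType}.

Lemma measurable_Gamma_integrand (a : R) (D : set R) :
  measurable_fun D (fun s : R => (s `^ (a - 1) * expR (- s))%:E).
Proof.
apply/measurable_EFinP/measurable_funTS/measurable_funM.
  exact: measurable_powR.
by apply: measurableT_comp => //; exact: measurable_oppr.
Qed.

Lemma integral_Gamma_lty (a : R) : 0 < a ->
  (\int[lebesgue_measure]_(s in `]0%R, +oo[) (s `^ (a - 1) * expR (- s))%:E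
    < +oo)%E.
Proof.
move=> a0.
have mI := @measurable_Gamma_integrand a.
have I0 (s : R) : (0 <= (s `^ (a - 1) * expR (- s))%:E)%E.
  by rewrite lee_fin mulr_ge0 ?powR_ge0 ?expR_ge0.
rewrite (_ : `]0%R, +oo[%classic = `]0%R, 1[%classic `|` `[1%R, +oo[%classic); last first.
  apply/seteqP; split => s /=; rewrite !in_itv/= ?andbT.
    by move=> s0; have [s1|s1] := ltP s 1; [left|right]; rewrite ?s0.
  by case=> [/andP[]//|]; exact: lt_le_trans.
rewrite ge0_integral_setU//=; last 2 first.
- exact: mI.
- apply/disj_setPS => s [] /=; rewrite !in_itv/= andbT => /andP[_ s1].
  by rewrite leNgt s1.
apply: lte_add_pinfty.
  apply: (@le_lt_trans _ _ (\int[lebesgue_measure]_(s in `]0%R, 1%R[) ((s - 0) `^ (a - 1))%:E)%E).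
    apply: ge0_le_integral => //.
    - exact: mI.
    - by apply/measurable_EFinP; exact: measurable_powR_shift.
    - move=> s; rewrite /= in_itv/= => /andP[s0 _]; rewrite lee_fin subr0.
      by rewrite ler_piMr ?powR_ge0// -expR0 ler_expR oppr_le0 ltW.
  exact: (le_lt_trans (integral_powR_shift_le 0 1 a a0 ltr01) (ltry _)).
have half0 : 0 < 2^-1 :> R by rewrite invr_gt0.
pose C := 2 * (2 * a) `^ a.
have C0 : 0 <= C by rewrite mulr_ge0 ?powR_ge0.
have mexp (D : set (measurableTypeR R)) :
    measurable_fun D (EFin \o exponential_pdf (2^-1 : R)).
  apply/measurable_EFinP/measurable_funTS.
  exact: measurable_exponential_pdf.
have exp0 (s : R) : (0 <= (exponential_pdf (2^-1 : R) s)%:E)%E.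
  by rewrite lee_fin exponential_pdf_ge0// ltW.
apply: (@le_lt_trans _ _ (\int[lebesgue_measure]_s
    (C%:E * (exponential_pdf (2^-1) s)%:E))%E).
  apply: (@le_trans _ _ (\int[lebesgue_measure]_(s in `[1%R, +oo[)
    (C%:E * (exponential_pdf (2^-1) s)%:E))%E).
    apply: ge0_le_integral => //.
    - exact: mI.
    - by apply: measurable_funeM; exact: mexp.
    - move=> s; rewrite /= in_itv/= andbT => s1.
      have s0 : 0 < s by exact: lt_le_trans s1.
      rewrite -EFinM lee_fin (exponential_pdfE _ (ltW s0)).
      (* as s / (2a) <= exp (s / (2a)), one has s^a <= (2a)^a exp (s / 2) *)
      have h : s `^ a <= (2 * a) `^ a * expR (s / 2).
        have a2 : 0 < 2 * a by rewrite mulr_gt0.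
        have -> : s `^ a = (2 * a) `^ a * (s / (2 * a)) `^ a.
          rewrite -powRM ?divr_ge0 ?ltW//; congr (_ `^ _).
          by rewrite mulrC divfK// gt_eqF.
        rewrite ler_wpM2l ?powR_ge0//.
        have -> : expR (s / 2) = expR (s / (2 * a)) `^ a.
          rewrite -expRM; congr expR.
          by field; rewrite gt_eqF.
        apply: ge0_ler_powR; rewrite ?nnegrE ?expR_ge0//; first exact: ltW.
          by rewrite divr_ge0// ltW.
        by apply: le_trans (expR_ge1Dx _); rewrite lerDr.
      have -> : C * (2^-1 * expR (- 2^-1 * s)) = (2 * a) `^ a * expR (s / 2) * expR (- s).
        rewrite -[RHS]mulrA -expRD /C.
        rewrite (_ : s / 2 - s = - 2^-1 * s); last by lra.
        by field.
      rewrite ler_wpM2r ?expR_ge0//.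
      apply: le_trans h; rewrite ler_powR//.
      by rewrite lerBlDr lerDl.
  apply: ge0_subset_integral => //.
  - by apply: measurable_funeM; exact: mexp.
  - by move=> s _; rewrite mule_ge0.
rewrite ge0_integralZl//=.
by rewrite integral_exponential_pdf// mule1 ltry.
Qed.

(** [Gamma] is defined as a real-valued integral, whose value would be 0 if the
    integrand were not integrable: hence the need for [integral_Gamma_lty]. *)
Lemma Gamma_gt0 (a : R) : 0 < a -> 0 < Gamma a.
Proof.
move=> a0; rewrite /Gamma /Rintegral fine_gt0//.
rewrite integral_Gamma_lty// andbT.
have mI := @measurable_Gamma_integrand a.
have I0 (s : R) : (0 <= (s `^ (a - 1) * expR (- s))%:E)%E.
  by rewrite lee_fin mulr_ge0 ?powR_ge0 ?expR_ge0.
have c0 : 0 < 2^-1 * expR (- 2) :> R by rewrite mulr_gt0 ?expR_gt0 ?invr_gt0.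
apply: (@lt_le_trans _ _ (\int[lebesgue_measure]_(s in `]1%R, 2%R[)
    (2^-1 * expR (- 2))%:E)%E).
  rewrite integral_cst//= lebesgue_measure_itv/= lte_fin ltr1n.
  rewrite -EFinB -EFinM lte_fin.
  by apply: mulr_gt0 => //; lra.
apply: (@le_trans _ _ (\int[lebesgue_measure]_(s in `]1%R, 2%R[)
    (s `^ (a - 1) * expR (- s))%:E)%E).
  apply: ge0_le_integral => //.
  - exact: mI.
  - move=> s; rewrite /= in_itv/= => /andP[s1 s2]; rewrite lee_fin.
    have s0 : 0 < s by exact: lt_trans s1.
    apply: ler_pM; rewrite ?expR_ge0 ?invr_ge0//; last by rewrite ler_expR lerN2 ltW.
    have -> : s `^ (a - 1) = s `^ a / s.
      by rewrite -(mulr_powRB1 (ltW s0) a0) mulrAC divff ?mul1r// gt_eqF.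
    rewrite -[leLHS]mul1r; apply: ler_pM; rewrite ?invr_ge0//.
      by rewrite -(powRr0 s) ler_powR// ltW.
    by rewrite lef_pV2 ?posrE// ltW.
apply: ge0_subset_integral => //; first exact: mI.
by move=> s /=; rewrite !in_itv/= andbT => /andP[s1 _]; exact: lt_trans s1.
Qed.

End Gamma_positive.

Lemma nneseries_geometric_lty {R : realType} (u : nat -> \bar R) (A x : R) :
  0 <= A -> 0 < x < 1 ->
  (forall j, 0 <= u j)%E -> (forall j, u j <= (A * x ^+ j)%:E)%E ->
  (\sum_(j <oo) u j < +oo)%E.
Proof.
move=> A0 /andP[x0 x1] u0 ux.
apply: (@le_lt_trans _ _ (A * (1 - x)^-1)%:E); last exact: ltry.
apply: lime_le; first exact: is_cvg_nneseries.
apply: nearW => N; apply: (@le_trans _ _ (\sum_(0 <= j < N) (A * x ^+ j)%:E)%E).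
  exact: lee_sum.
rewrite sumEFin lee_fin; apply: geometric_le_lim => //.
by rewrite gtr0_norm.
Qed.

(** * Product integrals and cubes in R^n *)

Section product_integrals.
Context {R : realType}.
Local Open Scope ereal_scope.

Lemma ge0_integral_lebesgue_Rn_prod n (g : 'I_n -> measurableTypeR R -> R) :
  (forall i, measurable_fun [set: measurableTypeR R] (g i)) ->
  (forall i t, (0 <= g i t)%R) ->
  \int[lebesgue_Rn n]_x (\prod_(i < n) g i (tnth x i))%:E =
  \prod_(i < n) \int[lebesgue_measure]_t (g i t)%:E.
Proof.
elim: n g => [|n ih] g mg g0.
  rewrite big_ord0 integral_dirac//= ?diracT ?mul1e ?big_ord0//.
  under eq_fun do rewrite big_ord0.
  exact: measurable_cst.
have mP : measurable_fun [set: Rn R n.+1]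
    (fun x => (\prod_(i < n.+1) g i (tnth x i))%:E).
  apply/measurable_EFinP; apply: measurable_prod => i _.
  apply: (measurableT_comp (mg i)); exact: measurable_tnth.
rewrite [LHS](ge0_integral_pushforward (@measurable_cons_Rn R n))//; last first.
  by move=> x _; rewrite lee_fin prodr_ge0.
rewrite preimage_setT fubini_tonelli1//; last 2 first.
- by apply: measurableT_comp => //; exact: measurable_cons_Rn.
- by move=> x; rewrite lee_fin prodr_ge0.
have mQ : measurable_fun [set: Rn R n]
    (fun x => (\prod_(i < n) g (lift ord0 i) (tnth x i))%:E).
  apply/measurable_EFinP; apply: measurable_prod => i _.
  by apply: (measurableT_comp (mg _)); exact: measurable_tnth.
have I0 : 0 <= \int[lebesgue_measure]_t (g ord0 t)%:E.
  by apply: integral_ge0 => t _; rewrite lee_fin.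
rewrite /fubini_F big_ord_recl -ih// -ge0_integralZl//; last first.
  by move=> x _; rewrite lee_fin prodr_ge0.
apply: eq_integral => x _ /=.
transitivity (\int[lebesgue_measure]_t
    ((g ord0 t)%:E * (\prod_(i < n) g (lift ord0 i) (tnth x i))%:E)).
  apply: eq_integral => t _; rewrite /= big_ord_recl tnth0 EFinM.
  by congr (_ * _%:E)%E; apply: eq_bigr => i _; rewrite /cons_Rn tnthS.
rewrite ge0_integralZr//; last 2 first.
- by move=> t _; rewrite lee_fin.
- by rewrite lee_fin prodr_ge0.
exact/measurable_EFinP.
Qed.

End product_integrals.

Section boxes.
Context {R : realType} {n : nat}.

Lemma measurable_coord_preimage (i : 'I_n) (A : set (measurableTypeR R)) :
  measurable A -> measurable [set x : Rn R n | A (tnth x i)].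
Proof.
move=> mA; have /(_ measurableT A mA) := @measurable_tnth _ (measurableTypeR R) n i.
by rewrite setTI.
Qed.

Lemma lebesgue_Rn_cube (r : R) : 0 <= r ->
  lebesgue_Rn n [set x | forall i, 0 < (tnth x i : R) < r] = (r ^+ n)%:E.
Proof.
move=> r0.
have := @lebesgue_Rn_box R n (fun=> `]0, r[%classic) (fun=> measurable_itv _).
rewrite (_ : [set x | _] = [set x | forall i, 0 < (tnth x i : R) < r]); last first.
  by apply/seteqP; split=> x /= h i; have := h i; rewrite in_itv.
move=> ->; rewrite lebesgue_measure_itv/= lte_fin.
have [r1|r1] := ltP 0 r.
  by rewrite -EFinB subr0 prodEFin prodr_const card_ord.
have -> : r = 0 by apply/eqP; rewrite eq_le r0 r1.
case: n => [|k]; first by rewrite big_ord0 expr0.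
by rewrite big_ord_recl mul0e expr0n.
Qed.

End boxes.

(** * The heat kernel *)

Section heat_kernel.
Context {R : realType} {n : nat}.
Implicit Types (x y : Rn R n) (t a : R) (z w : RnR R n).

Lemma norm_Rn_sqr x : norm_Rn x ^+ 2 = \sum_(i < n) (tnth x i : R) ^+ 2.
Proof. by rewrite sqr_sqrtr// sumr_ge0// => i _; exact: sqr_ge0. Qed.

Lemma norm_sub_Rn_sqr x y :
  norm_Rn (sub_Rn x y) ^+ 2 = \sum_(i < n) ((tnth x i : R) - tnth y i) ^+ 2.
Proof. by rewrite norm_Rn_sqr; apply: eq_bigr => i _; rewrite tnth_mktuple. Qed.

Lemma Phi_ge0 a x t : 0 < a -> 0 <= Phi a x t.
Proof.
move=> a0; rewrite /Phi; case: ifP => // t0.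
rewrite mulr_ge0 ?expR_ge0// mulr_ge0//; last by rewrite divr_ge0 ?powR_ge0.
by rewrite divr_ge0 ?powR_ge0// ltW// Gamma_gt0.
Qed.

(** In each coordinate the heat kernel at time t is the normal density with
    variance 2t. *)
Lemma Phi_normal_pdf a x y t : 0 < t ->
  Phi a (sub_Rn x y) t = t `^ (a - 1) / Gamma a *
    \prod_(i < n) normal_pdf (tnth y i : R) (Num.sqrt (2 * t)) (tnth x i).
Proof.
move=> t0; rewrite /Phi t0 -mulrA; congr (_ * _).
have s0 : Num.sqrt (2 * t) != 0 by rewrite gt_eqF// sqrtr_gt0 mulr_gt0.
have ss : Num.sqrt (2 * t) ^+ 2 = 2 * t by rewrite sqr_sqrtr// mulr_ge0// ltW.
under eq_bigr do rewrite normal_pdfE//.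
rewrite big_split/= prodr_const card_ord; congr (_ * _).
  rewrite /normal_peak ss exprVn div1r; congr (_ ^-1).
  rewrite [_ / 2]mulrC powRrM powR_mulrn ?powR_ge0//; congr (_ ^+ _).
  rewrite powR12_sqrt ?mulr_ge0 ?pi_ge0 ?ltW//.
  congr Num.sqrt; ring.
rewrite norm_sub_Rn_sqr /normal_fun ss -expR_sum; congr expR.
rewrite mulr_suml -sumrN; apply: eq_bigr => i _.
by rewrite -mulNr; congr (_ / _); ring.
Qed.

Lemma integral_Phi_space a y t : 0 < a -> 0 < t ->
  (\int[lebesgue_Rn n]_x (Phi a (sub_Rn x y) t)%:E
    = (t `^ (a - 1) / Gamma a)%:E)%E.
Proof.
move=> a0 t0; under eq_integral do rewrite Phi_normal_pdf// EFinM.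
rewrite ge0_integralZl//=; last 3 first.
- apply/measurable_EFinP; apply: measurable_prod => i _.
  apply: (measurableT_comp (measurable_normal_pdf _ _)).
  exact: measurable_tnth.
- by move=> x _; rewrite lee_fin prodr_ge0// => i _; exact: normal_pdf_ge0.
- by rewrite lee_fin divr_ge0 ?powR_ge0// ltW// Gamma_gt0.
rewrite (ge0_integral_lebesgue_Rn_prod n
  (fun i => normal_pdf (tnth y i : R) (Num.sqrt (2 * t)))); last 2 first.
- by move=> i; exact: measurable_normal_pdf.
- by move=> i x; exact: normal_pdf_ge0.
by rewrite big1 ?mule1// => i _; exact: integral_normal_pdf.
Qed.

Lemma measurable_Phi a d (T : measurableType d) (x y : T -> Rn R n) (t : T -> R) :
  measurable_fun [set: T] x -> measurable_fun [set: T] y -> measurable_fun [set: T] t ->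
  measurable_fun [set: T] (fun u => Phi a (sub_Rn (x u) (y u)) (t u)).
Proof.
move=> mx my mt.
(* inverses are written as powers, whose measurability is at hand *)
rewrite (_ : (fun u => _) = fun u => if 0 < t u then
    (t u) `^ (a - 1) * (Gamma a)^-1 * (4 * pi * t u) `^ (- (n%:R / 2)) *
    expR (- ((\sum_(i < n) ((tnth (x u) i : R) - tnth (y u) i) ^+ 2) *
             (4 * t u) `^ (- 1))) else 0); last first.
  apply/funext => u; rewrite /Phi; case: ifPn => // tz0.
  by rewrite powRN div1r powR_inv1 ?norm_sub_Rn_sqr// mulr_ge0// ltW.
have mcoord (v : T -> Rn R n) i : measurable_fun [set: T] v ->
    measurable_fun [set: T] (fun u => tnth (v u) i : R).
  by move=> mu; exact: (measurableT_comp (@measurable_tnth _ (measurableTypeR R) n i)).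
have mpow c k : measurable_fun [set: T] (fun u => (c * t u) `^ k).
  apply: (measurableT_comp (measurable_powR k)).
  exact: measurable_funM.
apply: measurable_fun_ifT => //.
  exact: measurable_fun_ltr.
apply: measurable_funM.
  apply: measurable_funM => //; apply: measurable_funM => //.
  exact: (measurableT_comp (measurable_powR _)).
apply: measurableT_comp => //; apply: measurableT_comp => //.
apply: measurable_funM => //; apply: measurable_sum => i.
by apply: measurable_funX; apply: measurable_funB; exact: mcoord.
Qed.

End heat_kernel.

(** * Fractional heat potentials *)

Section heat_potential.
Context {R : realType} {n : nat}.
Implicit Types (a T : R) (z w : RnR R n) (f : RnR R n -> R).

(** The extended-real integral behind [J]; unlike [J] it is still meaningful
    where it diverges. *)
Definition potential a f z : \bar R :=
  (\int[lebesgue_RnR]_w (Phi a (sub_Rn z.1 w.1) ((z.2 : R) - w.2) * f w)%:E)%E.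

Definition before T : set (RnR R n) := [set: Rn R n] `*` `]-oo, T[.

Lemma measurable_before T : measurable (before T).
Proof. by apply: measurableX. Qed.

Lemma J_potential a f z : J a f z = fine (potential a f z).
Proof.
rewrite /J /Rintegral /potential integral_mkcond; congr fine.
apply: eq_integral => w _; rewrite patchE; case: ifPn => //.
rewrite notin_setE/= => zw; rewrite /Phi ifF ?mul0r//.
apply/negbTE/negP; rewrite subr_gt0 => wz; apply: zw; split => //=.
Qed.

Lemma measurable_kernel_mul a f : measurable_fun [set: RnR R n] f ->
  measurable_fun [set: RnR R n * RnR R n]
    (fun zw => (Phi a (sub_Rn zw.1.1 zw.2.1) ((zw.1.2 : R) - zw.2.2) * f zw.2)%:E).
Proof.
move=> mf; apply/measurable_EFinP; apply: measurable_funM; last first.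
  exact: (measurableT_comp mf).
apply: measurable_Phi.
- exact: measurableT_comp.
- exact: measurableT_comp.
- by apply: measurable_funB; exact: measurableT_comp.
Qed.

Lemma kernel_mul_ge0 a f z w : 0 < a -> (forall w, 0 <= f w) ->
  (0 <= (Phi a (sub_Rn z.1 w.1) ((z.2 : R) - w.2) * f w)%:E)%E.
Proof. by move=> a0 f0; rewrite lee_fin mulr_ge0// Phi_ge0. Qed.

Lemma potential_ge0 a f z : 0 < a -> (forall w, 0 <= f w) -> (0 <= potential a f z)%E.
Proof. by move=> a0 f0; apply: integral_ge0 => w _; exact: kernel_mul_ge0. Qed.

Lemma measurable_potential a f : 0 < a -> measurable_fun [set: RnR R n] f ->
  (forall w, 0 <= f w) -> measurable_fun [set: RnR R n] (potential a f).
Proof.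
move=> a0 mf f0.
apply: (measurable_fun_fubini_tonelli_F (m2 := lebesgue_RnR)
  (fun zw : RnR R n * RnR R n =>
    (Phi a (sub_Rn zw.1.1 zw.2.1) ((zw.1.2 : R) - zw.2.2) * f zw.2)%:E)).
  exact: measurable_kernel_mul.
by move=> [z w]; exact: kernel_mul_ge0.
Qed.

Lemma measurable_J a f : 0 < a -> measurable_fun [set: RnR R n] f ->
  (forall w, 0 <= f w) -> measurable_fun [set: RnR R n] (J a f).
Proof.
move=> a0 mf f0; rewrite (_ : J a f = fine \o potential a f); last first.
  by apply/funext => z; rewrite J_potential.
by apply: measurableT_comp => //; exact: measurable_potential.
Qed.

(** The kernel vanishes at nonpositive elapsed times. *)
Lemma potential_eq0 a f z : (forall w, (w.2 : R) < z.2 -> f w = 0) ->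
  potential a f z = 0%E.
Proof.
move=> f0; apply: integral0_eq => w _.
have [wz|zw] := ltP (w.2 : R) z.2; first by rewrite f0// mulr0.
by rewrite /Phi ifF ?mul0r// ltNge subr_le0 zw.
Qed.

(** The spatial mass of the kernel at elapsed time t is
    t^(a - 1) / Gamma(a), which is integrable near t = 0.  The
    truncation at 0 accounts for points w later than T, whose influence never
    reaches the region. *)
Lemma integral_Phi_before a T w : 0 < a ->
  (\int[lebesgue_RnR]_(z in before T) (Phi a (sub_Rn z.1 w.1) ((z.2 : R) - w.2))%:E
    <= (Num.max 0 (T - w.2) `^ a / (a * Gamma a))%:E)%E.
Proof.
move=> a0; have G0 := @Gamma_gt0 R a a0.
pose F z := (Phi a (sub_Rn z.1 w.1) ((z.2 : R) - w.2))%:E.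
have mF : measurable_fun [set: RnR R n] F.
  apply/measurable_EFinP; apply: measurable_Phi => //.
  exact: measurable_funB.
have F0 z : (0 <= F z)%E by rewrite lee_fin Phi_ge0.
rewrite integral_mkcond fubini_tonelli2//; last 2 first.
- by apply/(measurable_restrictT _ _).1 => //; [exact: measurable_before|exact: measurable_funTS].
- by move=> z; rewrite patchE; case: ifP => // _; exact: F0.
rewrite (_ : (\int[_]_y _)%E = (\int[lebesgue_measure]_(t in `](w.2 : R), T[)
    ((Gamma a)^-1%:E * ((t - w.2) `^ (a - 1))%:E))%E); last first.
  rewrite [RHS]integral_mkcond; apply: eq_integral => t _.
  rewrite patchE /fubini_G; case: ifPn.
    rewrite inE/= in_itv/= => /andP[wt tT].
    under eq_integral.
      move=> x _; rewrite patchE mem_set; last by split => //=; rewrite in_itv.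
      over.
    by rewrite /= integral_Phi_space ?subr_gt0// mulrC EFinM.
  rewrite notin_setE/= in_itv/= => /negP; rewrite negb_and => h.
  apply: integral0_eq => x _; rewrite patchE; case: ifPn => //.
  rewrite inE => -[_] /=; rewrite in_itv/= => tT.
  rewrite /Phi ifF// subr_gt0; apply/negbTE.
  by case/orP : h => //; rewrite tT.
rewrite ge0_integralZl//=; last 3 first.
- by apply/measurable_EFinP; exact: measurable_powR_shift.
- by move=> t _; rewrite lee_fin powR_ge0.
- by rewrite lee_fin invr_ge0 ltW.
have [wT|Tw] := ltP (w.2 : R) T; last first.
  rewrite set_itv_ge ?integral_set0 ?mule0; last by rewrite bnd_simp -leNgt.
  by rewrite lee_fin divr_ge0 ?powR_ge0// mulr_ge0// ltW.
apply: le_trans; first apply: lee_wpmul2l.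
- by rewrite lee_fin invr_ge0 ltW.
- exact: integral_powR_shift_le.
have T0 : 0 <= T - w.2 by rewrite subr_ge0 ltW.
rewrite -EFinM lee_fin (max_r T0).
rewrite le_eqVlt; apply/orP; left; apply/eqP; field.
by rewrite !gt_eqF.
Qed.

(** By Tonelli's theorem the potential is integrable over the times before T:
    integrating the kernel first over its endpoint costs at most the constant
    of [integral_Phi_before], uniformly over starting points with nonnegative
    time. *)
Lemma ae_potential_lty a f T : 0 < a -> measurable_fun [set: RnR R n] f ->
  (forall w, 0 <= f w) -> (\int[lebesgue_RnR]_w (f w)%:E < +oo)%E ->
  (forall w, (w.2 : R) < 0 -> f w = 0) ->
  {ae lebesgue_RnR, forall z, (z.2 : R) < T -> (potential a f z < +oo)%E}.
Proof.
move=> a0 mf f0 foo fneg; have G0 := @Gamma_gt0 R a a0.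
pose C := Num.max 0 T `^ a / (a * Gamma a).
have C0 : 0 <= C by rewrite divr_ge0 ?powR_ge0// mulr_ge0// ltW.
pose K (zw : RnR R n * RnR R n) :=
  (Phi a (sub_Rn zw.1.1 zw.2.1) ((zw.1.2 : R) - zw.2.2) * f zw.2)%:E.
pose KT := K \_ (before T `*` [set: RnR R n]).
have mT := measurable_before T.
have mK : measurable_fun [set: RnR R n * RnR R n] K by exact: measurable_kernel_mul.
have mKT : measurable_fun [set: RnR R n * RnR R n] KT.
  apply/(measurable_restrictT _ _).1; first exact: measurableX.
  exact: measurable_funTS.
have KT0 zw : (0 <= KT zw)%E.
  by rewrite /KT patchE; case: ifPn => // _; exact: kernel_mul_ge0.
suff intoo : (\int[lebesgue_RnR]_(z in before T) potential a f z < +oo)%E.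
  have : lebesgue_RnR.-integrable (before T) (potential a f).
    apply/integrableP; split.
      by apply: measurable_funTS; exact: measurable_potential.
    under eq_integral do rewrite gee0_abs ?potential_ge0//.
    exact: intoo.
  move=> /(integrable_ae mT); apply: filterS => z h zT.
  by rewrite ltey_eq h//; split => //=; rewrite in_itv.
have -> : (\int[lebesgue_RnR]_(z in before T) potential a f z =
    \int[lebesgue_RnR]_z \int[lebesgue_RnR]_w KT (z, w))%E.
  rewrite integral_mkcond; apply: eq_integral => z _.
  rewrite patchE; case: ifPn => zT.
    apply: eq_integral => w _; rewrite /KT patchE ifT//.
    by rewrite inE; split => //=; move: zT; rewrite inE.
  apply/esym/integral0_eq => w _; rewrite /KT patchE ifF//.
  by apply/negbTE; move: zT; rewrite !notin_setE; apply: contra_not => -[].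
rewrite (fubini_tonelli KT)//.
apply: (@le_lt_trans _ _ (\int[lebesgue_RnR]_w (C%:E * (f w)%:E))%E); last first.
  rewrite ge0_integralZl//=.
  - by apply: lte_mul_pinfty => //; rewrite lee_fin.
  - exact/measurable_EFinP.
  - by move=> w _; rewrite lee_fin.
apply: ge0_le_integral => //.
- by move=> w _; apply: integral_ge0 => z _; exact: KT0.
- exact: (measurable_fun_fubini_tonelli_G KT).
- by apply: measurable_funeM; exact/measurable_EFinP.
move=> w _.
have [w0|w0] := ltP (w.2 : R) 0.
  rewrite fneg// mule0 integral0_eq// => z _.
  by rewrite /KT patchE; case: ifPn => // _; rewrite /K/= fneg// mulr0.
have mP : measurable_fun [set: RnR R n]
    (fun z => (Phi a (sub_Rn z.1 w.1) ((z.2 : R) - w.2))%:E).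
  by apply/measurable_EFinP; apply: measurable_Phi => //; exact: measurable_funB.
have -> : (\int[lebesgue_RnR]_z KT (z, w) = (f w)%:E *
    \int[lebesgue_RnR]_(z in before T) (Phi a (sub_Rn z.1 w.1) ((z.2 : R) - w.2))%:E)%E.
  rewrite -ge0_integralZl//.
  - rewrite [RHS]integral_mkcond; apply: eq_integral => z _.
    rewrite /KT !patchE; case: ifPn => zT.
      rewrite ifT; first by rewrite -EFinM mulrC.
      by move: zT; rewrite !inE => -[].
    rewrite ifF//; apply/negbTE; move: zT; rewrite !notin_setE; apply: contra_not.
    by move=> zT; split.
  - exact: measurable_funTS.
  - by move=> z _; rewrite lee_fin Phi_ge0.
  - by rewrite lee_fin.
rewrite muleC; apply: lee_wpmul2r; first by rewrite lee_fin.
apply: le_trans (integral_Phi_before _ _ _ a0) _; rewrite lee_fin.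
apply: ler_wpM2r; first by rewrite invr_ge0 mulr_ge0// ltW.
apply: ge0_ler_powR; first exact: ltW.
- by rewrite nnegrE le_max lexx.
- by rewrite nnegrE le_max lexx.
rewrite ge_max le_max lexx/= le_max; apply/orP; right.
by rewrite lerBlDr lerDl.
Qed.

End heat_potential.

(** * Parabolic cells *)

Section parabolic_cells.
Context {R : realType} {n : nat}.
Implicit Types (s d r b : R) (z : RnR R n).

Lemma measurable_sqrt : measurable_fun [set: R] (@Num.sqrt R).
Proof. by apply: continuous_measurable_fun; exact: sqrt_continuous. Qed.

(** Cubic cross sections replace the balls |x| < sqrt (t - s): their volume is
    explicit and the parabolic scaling is the same. *)
Definition cell s d : set (RnR R n) :=
  [set z | s < (z.2 : R) < s + d /\
           forall i, 0 < (tnth z.1 i : R) < Num.sqrt ((z.2 : R) - s)].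

(** A product set inside the cell with vertex (0, s), of order r in time and
    sqrt r in space, away from the vertex. *)
Definition box s r : set (RnR R n) :=
  [set x : Rn R n | forall i, 0 < (tnth x i : R) < Num.sqrt (r / 2)] `*`
  `]s + r / 2, s + r[.

Lemma measurable_cube r :
  measurable [set x : Rn R n | forall i, 0 < (tnth x i : R) < r].
Proof.
rewrite (_ : [set x | _] = \bigcap_(i in [set: 'I_n])
    [set x : Rn R n | `]0, r[%classic (tnth x i : R)]); last first.
  apply/seteqP; split=> x /= h i; first by move=> _; rewrite /= in_itv; exact: h.
  by have := h i I; rewrite /= in_itv.
apply: fin_bigcap_measurable => // i _.
by apply: measurable_coord_preimage; exact: measurable_itv.
Qed.

Lemma measurable_box s r : measurable (box s r).
Proof. by apply: measurableX; [exact: measurable_cube|exact: measurable_itv]. Qed.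

Lemma measure_box s r : 0 < r ->
  lebesgue_RnR (box s r) = ((r / 2) `^ (n%:R / 2 + 1))%:E.
Proof.
move=> r0; have r2 : 0 < r / 2 by rewrite divr_gt0.
rewrite /lebesgue_RnR product_measure1E//; last exact: measurable_cube.
rewrite [X in (X * _)%E](lebesgue_Rn_cube _ (sqrtr_ge0 _))
  [X in (_ * X)%E]lebesgue_measure_itv/= lte_fin.
rewrite ifT; last by lra.
rewrite -EFinB -EFinM; congr EFin.
rewrite powRD; last by rewrite gt_eqF// implybT.
rewrite powRr1 ?(ltW r2)//; congr (_ * _); last by lra.
by rewrite [_ / 2 in RHS]mulrC powRrM powR12_sqrt ?(ltW r2)// powR_mulrn.
Qed.

Lemma measurable_cell s d : measurable (cell s d).
Proof.
rewrite (_ : cell s d = [set z | `]s, s + d[%classic (z.2 : R)] `&`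
    \bigcap_(i in [set: 'I_n])
      [set z | (0 < (tnth z.1 i : R)) && ((tnth z.1 i : R) < Num.sqrt ((z.2 : R) - s))]);
    last first.
  apply/seteqP; split => z [] /=; rewrite in_itv/=.
    by move=> h1 h2; split => // i _; exact: h2.
  by move=> h1 h2; split => // i; exact: h2.
have m2 : measurable_fun [set: RnR R n] (fun z => z.2 : R) by exact: measurable_snd.
have mi i : measurable_fun [set: RnR R n] (fun z => tnth z.1 i : R).
  exact: (measurableT_comp (@measurable_tnth _ (measurableTypeR R) n i)).
apply: measurableI.
  by rewrite -[X in measurable X]setTI; apply: m2 => //; exact: measurable_itv.
apply: fin_bigcap_measurable => // i _.
rewrite -[X in measurable X]setTI.
have mb : measurable_fun [set: RnR R n] (fun z =>
    (0 < (tnth z.1 i : R)) && ((tnth z.1 i : R) < Num.sqrt ((z.2 : R) - s))).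
  apply: measurable_and; apply: measurable_fun_ltr => //.
  apply: measurableT_comp; first exact: measurable_sqrt.
  exact: measurable_funB.
have := mb measurableT [set true] I.
by congr measurable; apply/seteqP; split.
Qed.

Lemma box_cell s r d : 0 < r <= d -> box s r `<=` cell s d.
Proof.
move=> /andP[r0 rd] z [] /= h1; rewrite in_itv/= => /andP[h2 h3]; split; first by lra.
move=> i; have /andP[-> h] := h1 i; apply: (lt_trans h).
by rewrite ltr_sqrt; lra.
Qed.

Lemma measurable_cylinder s : measurable (cylinder s : set (RnR R n)).
Proof.
have m2 : measurable_fun [set: RnR R n] (fun z => z.2 : R) by exact: measurable_snd.
have mi i : measurable_fun [set: RnR R n] (fun z => tnth z.1 i : R).
  exact: (measurableT_comp (@measurable_tnth _ (measurableTypeR R) n i)).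
have mb : measurable_fun [set: RnR R n] (fun z =>
    (norm_Rn z.1 < Num.sqrt s) && (s < (z.2 : R) < 2 * s)).
  apply: measurable_and; last by apply: measurable_and; exact: measurable_fun_ltr.
  apply: measurable_fun_ltr => //.
  apply: (measurableT_comp measurable_sqrt).
  by apply: measurable_sum => i; exact: measurable_funX.
have := mb measurableT [set true] I.
rewrite setTI; congr measurable; apply/seteqP; split => z /=.
  by move=> /andP.
by move=> [-> ->].
Qed.

Lemma cell_cylinder s d : 0 < d -> (n%:R + 1) * d <= s -> cell s d `<=` cylinder s.
Proof.
move=> d0 ds z [/andP[h1 h2] h].
have n0 : 0 <= n%:R :> R by [].
have nd : n%:R * d < s by lra.
have s0 : 0 < s by nra.
split; last by apply/andP; split => //; nra.
rewrite ltr_sqrt//; apply: le_lt_trans nd.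
have -> : n%:R * d = \sum_(i < n) d by rewrite sumr_const card_ord mulr_natl.
apply: ler_sum => i _.
have /andP[x0 x1] := h i.
have : (tnth z.1 i : R) ^+ 2 < Num.sqrt ((z.2 : R) - s) ^+ 2.
  by rewrite ltr_pXn2r// ?nnegrE ?sqrtr_ge0// ltW.
by rewrite sqr_sqrtr; lra.
Qed.

(** Integrating over x first turns the integral into that of
    (t - s)^(n/2 - b) over ]s, s + d[. *)
Lemma integral_cell_le s d b : 0 < d -> 0 < n%:R / 2 + 1 - b ->
  (\int[lebesgue_RnR]_(z in cell s d) (((z.2 : R) - s) `^ (- b))%:E
    <= (d `^ (n%:R / 2 + 1 - b) / (n%:R / 2 + 1 - b))%:E)%E.
Proof.
move=> d0 k0.
pose F z := (((z.2 : R) - s) `^ (- b))%:E.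
have mF : measurable_fun [set: RnR R n] F.
  apply/measurable_EFinP; apply: (measurableT_comp (measurable_powR _)).
  exact: measurable_funB.
have F0 z : (0 <= F z)%E by rewrite lee_fin powR_ge0.
rewrite integral_mkcond fubini_tonelli2//; last 2 first.
- apply/(measurable_restrictT _ _).1 => //; first exact: measurable_cell.
  exact: measurable_funTS.
- by move=> z; rewrite patchE; case: ifP => // _; exact: F0.
rewrite (_ : (\int[_]_y _)%E = (\int[lebesgue_measure]_(t in `]s, (s + d)%R[)
    ((t - s) `^ (n%:R / 2 + 1 - b - 1))%:E)%E).
  apply: le_trans (integral_powR_shift_le _ _ _ k0 _) _; first by lra.
  by rewrite addrC addKr.
rewrite [RHS]integral_mkcond; apply: eq_integral => t _.
rewrite patchE /fubini_G; case: ifPn.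
  rewrite inE/= in_itv/= => tsd; have ts : 0 < t - s by lra.
  transitivity (\int[lebesgue_Rn n]_(x in
      [set x : Rn R n | forall i, (0 < (tnth x i : R) < Num.sqrt (t - s))%R])
      ((t - s) `^ (- b))%:E)%E.
    rewrite [RHS]integral_mkcond; apply: eq_integral => x _; rewrite !patchE.
    have [h|h] := pselect (forall i, 0 < (tnth x i : R) < Num.sqrt (t - s)).
      by rewrite !mem_set.
    by rewrite !memNset// => -[].
  rewrite integral_cst; last exact: measurable_cube.
  rewrite [X in (_ * X)%E](lebesgue_Rn_cube _ (sqrtr_ge0 _)) -EFinM; congr EFin.
  rewrite (_ : n%:R / 2 + 1 - b - 1 = - b + 2^-1 * n%:R); last by lra.
  rewrite powRD; last by rewrite (gt_eqF ts) implybT.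
  by rewrite powRrM powR12_sqrt ?(ltW ts)// powR_mulrn ?sqrtr_ge0.
rewrite notin_setE/= in_itv/= => h.
apply: integral0_eq => x _; rewrite patchE memNset//.
by move=> [].
Qed.

End parabolic_cells.

(** * The potential of a point singularity *)

Section lower_bound.
Context {R : realType} {n : nat}.
Implicit Types (a b s d : R) (z w : RnR R n) (f g : RnR R n -> R).

Lemma integral_box_cst s r c : 0 < r ->
  (\int[lebesgue_RnR]_(_ in box s r : set (RnR R n)) c%:E
    = (c * (r / 2) `^ (n%:R / 2 + 1))%:E)%E.
Proof.
move=> r0.
have -> := @integral_cst _ _ R lebesgue_RnR _ (@measurable_box R n s r) c%:E.
by rewrite [X in (_ * X)%E](measure_box s r r0) -EFinM.
Qed.

(** The product of the lower bounds of the factors of the kernel in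
    [Phi_ge_on_box] and of the measure of the box, at unit scale. *)
Definition lower_const a : R :=
  2^-1 `^ a / Gamma a * (4 * pi) `^ (- (n%:R / 2)) * expR (- (n%:R / 2)) *
  4^-1 `^ (n%:R / 2 + 1).

Lemma lower_const_gt0 a : 0 < a -> 0 < lower_const a.
Proof.
move=> a0; rewrite /lower_const !mulr_gt0 ?expR_gt0 ?powR_gt0 ?invr_gt0//.
  exact: Gamma_gt0.
by rewrite mulr_gt0// pi_gt0.
Qed.

(** If z is at time S after the vertex and w is in the box of size S / 2, then
    the elapsed time t is between S / 2 and S, and both points are within
    sqrt S of the axis in each coordinate, so that the Gaussian exponent is
    at most n / 2.  The factor t^(a - 1) is bounded below as t^a / t, which
    works for both signs of a - 1. *)
Lemma Phi_ge_on_box a s d z w : 0 < a -> cell s d z ->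
  box s (((z.2 : R) - s) / 2) w ->
  (((z.2 : R) - s) / 2) `^ a / ((z.2 : R) - s) / Gamma a *
    (4 * pi * ((z.2 : R) - s)) `^ (- (n%:R / 2)) * expR (- (n%:R / 2))
  <= Phi a (sub_Rn z.1 w.1) ((z.2 : R) - w.2).
Proof.
move=> a0 [/andP[z1 z2] hz] [hw]; rewrite /= in_itv/= => /andP[w1 w2].
have G0 := Gamma_gt0 a a0.
set S := (z.2 : R) - s in w1 w2 *; set t := (z.2 : R) - w.2.
have S0 : 0 < S by rewrite subr_gt0.
have tS : S / 2 < t < S by apply/andP; split; rewrite /t/S in w1 w2 *; lra.
have [St tS'] := andP tS.
have t0 : 0 < t by lra.
have pi0 : 0 < pi :> R := pi_gt0 R.
rewrite /Phi t0.
apply: ler_pM.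
- by rewrite mulr_ge0 ?powR_ge0// divr_ge0 ?(ltW G0)// divr_ge0 ?powR_ge0// ltW.
- exact: expR_ge0.
- apply: ler_pM.
  + by rewrite divr_ge0 ?(ltW G0)// divr_ge0 ?powR_ge0// ltW.
  + exact: powR_ge0.
  + rewrite ler_pM2r ?invr_gt0//.
    rewrite (_ : t `^ (a - 1) = t `^ a / t); last first.
      by rewrite -(mulr_powRB1 (ltW t0) a0) mulrAC divff ?mul1r// gt_eqF.
    apply: ler_pM; rewrite ?powR_ge0 ?invr_ge0 ?(ltW S0)//.
      apply: ge0_ler_powR; rewrite ?nnegrE; lra.
    by rewrite lef_pV2 ?posrE// ltW.
  + rewrite div1r powRN lef_pV2 ?posrE ?powR_gt0 ?mulr_gt0//.
    apply: ge0_ler_powR; rewrite ?nnegrE ?divr_ge0 ?mulr_ge0 ?(ltW pi0) ?(ltW t0) ?(ltW S0)//.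
    by rewrite ler_pM2l ?mulr_gt0// ltW.
- rewrite ler_expR lerN2 norm_sub_Rn_sqr.
  rewrite ler_pdivrMr ?mulr_gt0//.
  apply: (@le_trans _ _ (n%:R * S)); last first.
    have : 0 <= n%:R :> R by [].
    nra.
  have -> : n%:R * S = \sum_(i < n) S by rewrite sumr_const card_ord mulr_natl.
  apply: ler_sum => i _.
  have /andP[x0 x1] := hz i; have /andP[y0 y1] := hw i.
  have r1 : Num.sqrt (S / 2 / 2) <= Num.sqrt S by rewrite ler_sqrt; lra.
  have -> : S = Num.sqrt S ^+ 2 by rewrite sqr_sqrtr// ltW.
  rewrite -/S in x1.
  rewrite -(real_normK (num_real (_ - _))) ler_pXn2r// ?nnegrE ?sqrtr_ge0//.
  by rewrite ler_norml; apply/andP; split; lra.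
Qed.

(** Only the part of f in the box of size S / 2 is used, S being the time
    elapsed since the vertex.  There f is at least S^(-b), the kernel is at
    least of order S^(a - 1 - n/2), and the box has measure of order
    S^(n/2 + 1). *)
Lemma potential_ge_on_cell a b s d f z : 0 < a -> 0 <= b ->
  measurable_fun [set: RnR R n] f -> (forall w, 0 <= f w) ->
  (forall w, cell s d w -> ((w.2 : R) - s) `^ (- b) <= f w) ->
  cell s d z ->
  ((lower_const a * ((z.2 : R) - s) `^ (a - b))%:E <= potential a f z)%E.
Proof.
move=> a0 b0 mf f0 fb cz; have [/andP[z1 z2] _] := cz.
have G0 := Gamma_gt0 a a0.
set S := (z.2 : R) - s.
have S0 : 0 < S by rewrite subr_gt0.
have pi0 : 0 < pi :> R := pi_gt0 R.
pose m := (S / 2) `^ a / S / Gamma a * (4 * pi * S) `^ (- (n%:R / 2)) *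
  expR (- (n%:R / 2)) * S `^ (- b).
have m0 : 0 <= m.
  rewrite !mulr_ge0 ?powR_ge0 ?expR_ge0 ?invr_ge0 ?(ltW G0) ?(ltW S0)//.
have mK : measurable_fun [set: RnR R n]
    (fun w => (Phi a (sub_Rn z.1 w.1) ((z.2 : R) - w.2) * f w)%:E).
  apply/measurable_EFinP; apply: measurable_funM => //.
  by apply: measurable_Phi => //; exact: measurable_funB.
apply: (@le_trans _ _ (\int[lebesgue_RnR]_(w in (box s (S / 2) : set (RnR R n))) m%:E)%E).
  have S2 : 0 < S / 2 by rewrite divr_gt0.
  rewrite integral_box_cst// lee_fin le_eqVlt; apply/orP; left; apply/eqP.
  rewrite (_ : S / 2 / 2 = 4^-1 * S); last by lra.
  rewrite /m /lower_const [S / 2]mulrC !powRM ?invr_ge0 ?mulr_ge0 ?(ltW pi0) ?(ltW S0)//.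
  have e : S `^ (a - b) = S `^ a / S * S `^ (- (n%:R / 2)) * S `^ (- b) * S `^ (n%:R / 2 + 1).
    rewrite -(powR_inv1 (ltW S0)) -!powRD ?(gt_eqF S0) ?implybT//.
    by congr (_ `^ _); ring.
  rewrite e; ring.
apply: (@le_trans _ _ (\int[lebesgue_RnR]_(w in box s (S / 2))
   (Phi a (sub_Rn z.1 w.1) ((z.2 : R) - w.2) * f w)%:E)%E).
  apply: ge0_le_integral => //.
  - exact: measurable_box.
  - exact: measurable_funTS.
  - move=> w bw; rewrite lee_fin /m.
    have cw : cell s d w by apply: box_cell bw; rewrite /S; lra.
    apply: ler_pM; rewrite ?powR_ge0//.
    + by rewrite !mulr_ge0 ?powR_ge0 ?expR_ge0 ?invr_ge0 ?(ltW G0) ?(ltW S0).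
    + exact: (Phi_ge_on_box a s d z w a0 cz bw).
    apply: le_trans (fb _ cw).
    have [/andP[w1 w2] _] := cw.
    have wS : (w.2 : R) - s <= S.
      by move: bw => [_]; rewrite /= in_itv/= => /andP[_ ?]; lra.
    rewrite !powRN lef_pV2 ?posrE ?powR_gt0 ?subr_gt0//.
    by apply: ge0_ler_powR; rewrite ?nnegrE ?(ltW S0)//; lra.
apply: ge0_subset_integral => //; first exact: measurable_box.
by move=> w _; exact: kernel_mul_ge0.
Qed.

End lower_bound.

(** * Finite and infinite norms *)

Section infinite_norm.
Context {R : realType} {n : nat}.
Implicit Types (b s d r : R) (z : RnR R n) (g : RnR R n -> R).

Lemma powRN_large d c A : 0 < d -> 0 < c -> exists2 r : R, 0 < r <= d & A <= r `^ (- c).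
Proof.
move=> d0 c0; pose B := Num.max A 1; have B0 : 0 < B by rewrite lt_max ltr01 orbT.
exists (Num.min d (B `^ (- c^-1))).
  by rewrite lt_min d0 powR_gt0// ge_min lexx.
set r := Num.min _ _; have r0 : 0 < r by rewrite lt_min d0 powR_gt0.
apply: (@le_trans _ _ B); first by rewrite le_max lexx.
rewrite powRN -[B]invrK lef_pV2 ?posrE ?powR_gt0 ?invr_gt0//.
have -> : B^-1 = (B `^ (- c^-1)) `^ c.
  by rewrite -powRrM mulNr mulVf ?gt_eqF// powR_inv1// ltW.
apply: ge0_ler_powR; rewrite ?nnegrE ?powR_ge0 ?(ltW c0) ?(ltW r0)//.
by rewrite ge_min lexx orbT.
Qed.

(** It suffices to look at the boxes of size r near the vertex, as r tends to 0.
    On such a box g is at least r^(-b), which is unbounded, and the box has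
    positive measure: this settles q = +oo.  For finite q the box contributes
    at least r^(-bq) times its measure, which is of order r^(n/2 + 1). *)
Lemma Lnorm_on_cell_infinite (D : set (RnR R n)) (q : \bar R) g s d b :
  measurable D -> measurable_fun [set: RnR R n] g -> cell s d `<=` D ->
  0 < d -> 0 < b -> (0%:E < q)%E -> ((n%:R / 2 + 1)%:E < b%:E * q)%E ->
  {ae lebesgue_RnR, forall z, cell s d z -> ((z.2 : R) - s) `^ (- b) <= g z} ->
  Lnorm_on D q g = +oo%E.
Proof.
move=> mD mg sD d0 b0 q0 bq gb.
have mgD : measurable_fun [set: RnR R n] (g \_ D).
  by apply/(measurable_restrictT _ _).1 => //; exact: measurable_funTS.
have gbox r : 0 < r <= d ->
    {ae lebesgue_RnR, forall z, box s r z -> r `^ (- b) <= `|(g \_ D) z|}.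
  move=> rd; have [r0 _] := andP rd; apply: filterS gb => z gz bz.
  have cz := box_cell s r d rd z bz; apply: le_trans (ler_norm _).
  rewrite patchE mem_set; last exact: sD.
  apply: le_trans (gz cz); have [/andP[z1 z2] _] := cz.
  rewrite !powRN lef_pV2 ?posrE ?powR_gt0 ?subr_gt0//.
  apply: ge0_ler_powR; rewrite ?nnegrE ?(ltW b0) ?(ltW r0)//; first by lra.
  by move: bz => [_]; rewrite /= in_itv/= => /andP[_ ?]; lra.
rewrite /Lnorm_on unlock; case: q q0 bq => [q||]//=; last first.
  move=> _ _.
  have pos r : 0 < r -> (0 < lebesgue_RnR (box s r : set (RnR R n)))%E.
    by move=> r0; rewrite measure_box// lte_fin powR_gt0// divr_gt0.
  rewrite ifT; last first.
    apply: (lt_le_trans (pos 1 ltr01)); apply: le_measure => //; rewrite ?inE//.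
    exact: measurable_box.
  apply/eqyP => A A0.
  have [r /andP[r0 rd] Ar] := powRN_large d b (A + 1) d0 b0.
  rewrite leNgt; apply/negP => supA.
  have : {ae lebesgue_RnR, forall z, ~ box s r z}.
    have rd' : 0 < r <= d by rewrite r0.
    apply: filterS2 (gbox r rd') (ess_sup_ge lebesgue_RnR (abse \o (EFin \o g \_ D))).
    move=> z h1 h2 /h1 h3; move: (le_lt_trans h2 supA); rewrite /= lte_fin.
    by apply/negP; rewrite -leNgt; lra.
  move=> h; have := pos r r0.
  rewrite (@negligibleP _ _ _ _ (box s r) (measurable_box _ _)).1 ?ltxx//.
  by move: h; congr negligible; apply/seteqP; split => z /=; [exact: contrapT|move=> ? []].
rewrite lte_fin => q0; rewrite -EFinM lte_fin => bq.
rewrite (_ : (\int[_]_x _)%E = +oo%E); first by rewrite poweRyr ?invr_neq0 ?gt_eqF.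
apply/eqyP => A A0.
pose c := b * q - (n%:R / 2 + 1); have c0 : 0 < c by rewrite subr_gt0.
have [r /andP[r0 rd] Ar] := powRN_large d c (A * 2 `^ (n%:R / 2 + 1)) d0 c0.
have rd' : 0 < r <= d by rewrite r0.
have mF : measurable_fun [set: RnR R n] (fun x => (`| ((g \_ D) x)%:E | `^ q)%E).
  apply: (measurableT_comp (measurable_poweR _)).
  by apply: measurableT_comp => //; exact/measurable_EFinP.
apply: (@le_trans _ _
    (\int[lebesgue_RnR]_(x in (box s r : set (RnR R n))) ((r `^ (- b)) `^ q)%:E)%E).
  rewrite integral_box_cst// lee_fin -powRrM powRM ?invr_ge0 ?(ltW r0)// mulrA -powRD; last first.
    by rewrite (gt_eqF r0) implybT.
  rewrite (_ : - b * q + _ = - c); last by rewrite /c; ring.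
  rewrite -(@ler_pM2r _ (2 `^ (n%:R / 2 + 1))) ?powR_gt0//.
  by rewrite -mulrA -powRM ?invr_ge0// mulVf// powR1 mulr1.
apply: (@le_trans _ _ (\int[lebesgue_RnR]_(x in box s r) (`| ((g \_ D) x)%:E | `^ q)%E)%E).
  apply: ae_ge0_le_integral => //.
  - exact: measurable_box.
  - by move=> x _; rewrite lee_fin powR_ge0.
  - by move=> x _; exact: poweR_ge0.
  - exact: measurable_funTS.
  apply: filterS (gbox r rd') => z h bz; rewrite /= lee_fin.
  by apply: ge0_ler_powR; rewrite ?nnegrE ?powR_ge0 ?(ltW q0)//; exact: h.
apply: ge0_subset_integral => //; first exact: measurable_box.
by move=> x _; exact: poweR_ge0.
Qed.

End infinite_norm.

Lemma Lnorm_on_lty {R : realType} {n : nat} (D : set (RnR R n)) (p : R) (f : RnR R n -> R) :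
  0 < p -> measurable D -> measurable_fun [set: RnR R n] f -> (forall z, 0 <= f z) ->
  (\int[lebesgue_RnR]_z (f z `^ p)%:E < +oo)%E -> (Lnorm_on D p%:E f < +oo)%E.
Proof.
move=> p0 mD mf f0 foo; rewrite /Lnorm_on unlock /=; apply: poweR_lty.
apply: le_lt_trans foo; apply: ge0_le_integral => //.
- apply/measurable_EFinP/(measurableT_comp (measurable_powR _)).
  apply: measurableT_comp => //.
  by apply/(measurable_restrictT _ _).1 => //; exact: measurable_funTS.
- by apply/measurable_EFinP/(measurableT_comp (measurable_powR _)).
- move=> z _; rewrite /= patchE; case: ifP => _.
    by rewrite ger0_norm.
  by rewrite normr0 powR0 ?gt_eqF// lee_fin powR_ge0.
Qed.

(** * A sequence of point singularities *)

Section source.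
Context {R : realType} {n : nat}.
Implicit Types (b c r : R) (z : RnR R n) (j : nat).

Definition dyadic j : R := 2^-1 * 2^-1 ^+ j.

Lemma dyadic_gt0 j : 0 < dyadic j.
Proof. by rewrite /dyadic mulr_gt0// exprn_gt0. Qed.

Lemma dyadic_le j k : (j < k)%N -> 2 * dyadic k <= dyadic j.
Proof.
move=> jk; rewrite /dyadic mulrA mulfV// mul1r -exprS.
by apply: ler_wiXn2l => //; rewrite ?invf_le1// ler1n.
Qed.

Lemma dyadic_le_half j : dyadic j <= 2^-1.
Proof.
rewrite /dyadic ler_piMr ?invr_ge0// exprn_ile1// ?invr_ge0//.
by rewrite invf_le1// ler1n.
Qed.

Lemma cvg_dyadic : dyadic @ \oo --> (0 : R).
Proof.
apply: cvg_geometric; rewrite ger0_norm ?invr_ge0//.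
by rewrite invf_lt1// ltr1n.
Qed.

Definition spot c j : set (RnR R n) := cell (dyadic j) (c * dyadic j).

Lemma spot_time c j z : c <= 1 -> spot c j z -> dyadic j < (z.2 : R) < 2 * dyadic j.
Proof.
move=> c1 [/andP[h1 h2] _]; rewrite h1/=; apply: (lt_le_trans h2).
have := dyadic_gt0 j; nra.
Qed.

Lemma trivIset_spot c : c <= 1 -> trivIset [set: nat] (spot c).
Proof.
move=> c1; apply: ltn_trivIset => k j jk; apply/seteqP; split => // z [zj zk].
have /andP[_ h1] := spot_time c k z c1 zk.
have /andP[h2 _] := spot_time c j z c1 zj.
by have := dyadic_le _ _ jk; rewrite leNgt (lt_trans h2 h1).
Qed.

Lemma measurable_spots c : measurable (\bigcup_j spot c j).
Proof. by apply: bigcup_measurable => j _; exact: measurable_cell. Qed.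

(** The spots are disjoint, so [get] returns the index of the only spot that
    contains z. *)
Definition source b c z : R :=
  if z \in \bigcup_j spot c j
  then ((z.2 : R) - dyadic (get [set j | spot c j z])) `^ (- b) else 0.

Lemma source_ge0 b c z : 0 <= source b c z.
Proof. by rewrite /source; case: ifP => // _; exact: powR_ge0. Qed.

Lemma source_spot b c j z : c <= 1 -> spot c j z ->
  source b c z = ((z.2 : R) - dyadic j) `^ (- b).
Proof.
move=> c1 cz; rewrite /source mem_set; last by exists j.
rewrite (@get_unique _ _ j)// => k ck.
apply: (trivIset_spot c c1 k j I I); by exists z.
Qed.

Lemma source_eq0 b c z : ~ (\bigcup_j spot c j) z -> source b c z = 0.
Proof. by move=> h; rewrite /source memNset. Qed.

Lemma measurable_source b c : c <= 1 -> measurable_fun [set: RnR R n] (source b c).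
Proof.
move=> c1; rewrite -(setvU (\bigcup_j spot c j)).
apply/measurable_funU; [| |split].
- by apply: measurableC; exact: measurable_spots.
- exact: measurable_spots.
- apply: (eq_measurable_fun (fun=> 0 : R)) => [z|]; last exact: measurable_cst.
  by rewrite inE => h; rewrite source_eq0.
apply/measurable_fun_bigcup => j; first exact: measurable_cell.
apply: (eq_measurable_fun (fun z => ((z.2 : R) - dyadic j) `^ (- b))).
  by move=> z; rewrite inE => cz; rewrite (source_spot b c j).
apply: measurable_funTS; apply: (measurableT_comp (measurable_powR _)).
exact: measurable_funB.
Qed.

(** The j-th spot contributes at most a constant times its height to the power
    n/2 + 1 - b r, and the heights are geometric. *)
Lemma integral_source_powR_lty b c r : 0 < c <= 1 -> 0 < r ->
  0 < n%:R / 2 + 1 - b * r ->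
  (\int[lebesgue_RnR]_z (source b c z `^ r)%:E < +oo)%E.
Proof.
move=> /andP[c0 c1] r0; set k := n%:R / 2 + 1 - b * r => k0.
have mU := measurable_spots c.
have mf : measurable_fun [set: RnR R n] (fun z => (source b c z `^ r)%:E).
  apply/measurable_EFinP/(measurableT_comp (measurable_powR _)).
  exact: measurable_source.
rewrite (_ : (\int[_]_z _)%E =
    (\int[lebesgue_RnR]_(z in \bigcup_j spot c j) (source b c z `^ r)%:E)%E); last first.
  rewrite [RHS]integral_mkcond; apply: eq_integral => z _; rewrite patchE.
  case: ifPn => //; rewrite notin_setE => h.
  by rewrite source_eq0// powR0// gt_eqF.
rewrite ge0_integral_bigcup//; last 4 first.
- by move=> j; exact: measurable_cell.
- exact: measurable_funTS.
- by move=> z _; rewrite lee_fin powR_ge0.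
- exact: trivIset_spot.
pose x : R := 2^-1 `^ k.
apply: (@nneseries_geometric_lty R _ ((c / 2) `^ k / k) x).
- by rewrite divr_ge0 ?powR_ge0// ltW.
- rewrite powR_gt0//=.
  apply: (@lt_le_trans _ _ (1 `^ k)); last by rewrite powR1.
  apply: gt0_ltr_powR; rewrite ?nnegrE//.
  by rewrite invf_lt1// ltr1n.
- by move=> j; apply: integral_ge0 => z _; rewrite lee_fin powR_ge0.
move=> j.
rewrite (_ : (\int[_]_(z in _) _)%E = (\int[lebesgue_RnR]_(z in spot c j)
    (((z.2 : R) - dyadic j) `^ (- (b * r)))%:E)%E); last first.
  apply: eq_integral => z; rewrite inE => cz.
  by rewrite (source_spot b c j)// -powRrM mulNr.
apply: le_trans (integral_cell_le _ _ _ _ k0) _.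
  by rewrite mulr_gt0// dyadic_gt0.
rewrite lee_fin -/k /dyadic /x mulrA powRM ?mulr_ge0 ?(ltW c0) ?exprn_ge0//.
rewrite le_eqVlt; apply/orP; left; apply/eqP.
rewrite mulrAC; congr (_ * _ * _).
by rewrite -[2^-1 ^+ j]powR_mulrn ?invr_ge0// powRAC powR_mulrn ?powR_ge0.
Qed.

End source.

(** Apart from b > 0, which follows, every condition on b is an inequality
    between b and one of the three thresholds m / p,
    alpha lambda / (lambda - 1) and m / q (which is 0 for q = +oo); the first
    exceeds both others.  In the application m is n/2 + 1, half the parabolic
    dimension of space-time. *)
Lemma exists_singularity_exponent {R : realType} (m p alpha lambda : R) (q : \bar R) :
  0 < p -> 0 < m -> 1 < lambda -> 0 < alpha < m / p * (1 - 1 / lambda) ->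
  (p%:E < q)%E ->
  exists b : R, [/\ 0 < b, b * p < m, alpha * lambda < b * (lambda - 1) &
                    (m%:E < b%:E * q)%E].
Proof.
move=> p0 m0 l1 /andP[a0 am] pq.
pose B := m / p.
have l0 : 0 < lambda by exact: lt_trans l1.
have l10 : 0 < lambda - 1 by rewrite subr_gt0.
pose A1 := alpha * lambda / (lambda - 1).
have A10 : 0 < A1 by rewrite divr_gt0// mulr_gt0.
have A1B : A1 < B.
  rewrite /A1 ltr_pdivrMr// -ltr_pdivlMr//.
  rewrite (_ : B * (lambda - 1) / lambda = m / p * (1 - 1 / lambda))//.
  by rewrite /B; field; rewrite !gt_eqF.
have [A2 A2B qA2] : exists2 A2 : R, A2 < B & forall b, 0 < b -> A2 < b -> (m%:E < b%:E * q)%E.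
  case: q pq => [q||]//=.
    rewrite lte_fin => pq; have q0 : 0 < q by exact: lt_trans pq.
    exists (m / q).
      by rewrite /B ltr_pM2l// ltf_pV2 ?posrE.
    by move=> b b0; rewrite ltr_pdivrMr// -EFinM lte_fin.
  move=> _; exists 0; first by rewrite /B divr_gt0.
  by move=> b b0 _; rewrite gt0_muley ?lte_fin// ltry.
pose A := Num.max A1 A2.
have AB : A < B by rewrite gt_max A1B A2B.
have A1A : A1 <= A by rewrite le_max lexx.
have A2A : A2 <= A by rewrite le_max lexx orbT.
pose b := (A + B) / 2.
have Ab : A < b by rewrite /b; lra.
have bB : b < B by rewrite /b; lra.
have b0 : 0 < b by lra.
exists b; split => //.
- by rewrite -ltr_pdivlMr.
- by rewrite -ltr_pdivrMr//; exact: le_lt_trans Ab.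
- by apply: qA2 => //; exact: le_lt_trans Ab.
Qed.

(** * Blow-up along the cylinders *)

(* On nonnegative reals [`^] is the usual power; u >= 0 almost everywhere is
   forced by f >= 0, so its conventional values at negative bases are
   irrelevant. *)
Theorem theorem3p5 (R : realType) (n : nat) (p alpha lambda : R) (q : \bar R)
  (hn : (1 <= n)%N)
  (hpa : (1 < p /\ 0 < alpha < (n%:R + 2) / (2 * p)) \/
         (p = 1 /\ 0 < alpha <= (n%:R + 2) / (2 * p)))
  (hlambda : 1 < lambda)
  (halpha : 0 < alpha < (n%:R + 2) / (2 * p) * (1 - 1 / lambda))
  (hq : (p%:E < q)%E) :
  exists (u f : RnR R n -> R),
    [/\ Yspace p alpha u,
        is_heat_power p alpha u f,
        {ae lebesgue_RnR, forall z : RnR R n, 0 <= f z <= u z `^ lambda},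
        {ae lebesgue_RnR, forall z : RnR R n, (z.2 : R) < 0 -> u z = 0} &
        exists t_ : nat -> R,
          [/\ forall j, 0 < t_ j < 1,
              t_ @ \oo --> 0 &
              forall j,
                Lnorm_on (cylinder (t_ j)) q (fun z => u z `^ lambda) = +oo%E /\
                Lnorm_on (cylinder (t_ j)) q f = +oo%E]].
Proof.
have p1 : 1 <= p by case: hpa => [[/ltW//]|[->]].
have p0 : 0 < p by exact: lt_le_trans p1.
have a0 : 0 < alpha by case/andP: halpha.
have l0 : 0 < lambda by exact: lt_trans hlambda.
pose m : R := n%:R / 2 + 1.
have nR0 : 0 <= n%:R :> R by [].
have m0 : 0 < m by rewrite /m; lra.
have mE : (n%:R + 2) / (2 * p) = m / p by rewrite /m; field; rewrite gt_eqF.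
rewrite mE in halpha.
have [b [b0 bp ab bq]] := exists_singularity_exponent m p alpha lambda q p0 m0 hlambda halpha hq.
pose C := lower_const (n := n) alpha.
have C0 : 0 < C by exact: lower_const_gt0.
pose theta := (b - alpha) * lambda - b.
have theta0 : 0 < theta by rewrite /theta; lra.
have n10 : 0 < (n%:R + 1)^-1 :> R by rewrite invr_gt0; lra.
(* c makes the cells flat enough to fit into the cylinders (c <= 1 / (n + 1))
   and short enough for C^lambda S^(-theta) >= 1 whenever S <= c *)
have [c /andP[c0 cn] cA] := powRN_large _ theta ((C `^ lambda)^-1) n10 theta0.
have cn1 : (n%:R + 1) * c <= 1 by rewrite mulrC -ler_pdivlMr ?div1r//; lra.
have c1 : c <= 1 by nra.
pose f : RnR R n -> R := source b c.
pose u := J alpha f.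
have f0 z : 0 <= f z by exact: source_ge0.
have mf : measurable_fun [set: RnR R n] f by exact: measurable_source.
have mu : measurable_fun [set: RnR R n] u by exact: measurable_J.
have fneg z : (z.2 : R) < 0 -> f z = 0.
  move=> z0; apply: source_eq0 => -[j _] /(spot_time c j z c1) /andP[+ _].
  by have := dyadic_gt0 (R := R) j; lra.
have Xf : Xspace p f.
  split => // T; apply: Lnorm_on_lty => //; first exact: measurable_before.
  by apply: integral_source_powR_lty => //; [rewrite c0|rewrite -/m; lra].
(* f is integrable since b <= b p, as p >= 1 *)
have foo : (\int[lebesgue_RnR]_z (f z)%:E < +oo)%E.
  under eq_integral do rewrite -[f _]powRr1//.
  apply: integral_source_powR_lty => //; first by rewrite c0.
  rewrite -/m mulr1; nra.
have fle : {ae lebesgue_RnR, forall z : RnR R n, 0 <= f z <= u z `^ lambda}.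
  apply: filterS (ae_potential_lty alpha f 1 a0 mf f0 foo fneg) => z zoo.
  rewrite f0/=.
  have [[j _ cz]|nz] := pselect ((\bigcup_j spot c j) z); last first.
    by rewrite /f source_eq0// powR_ge0.
  have /andP[z1 z2] := spot_time c j z c1 cz.
  have tj := dyadic_le_half (R := R) j.
  have tj0 := dyadic_gt0 (R := R) j.
  have {}zoo : (potential alpha f z < +oo)%E by apply: zoo; lra.
  rewrite /f (source_spot b c j)//.
  have S0 : 0 < (z.2 : R) - dyadic j by lra.
  have Sc : (z.2 : R) - dyadic j <= c by case: cz => /andP[_ ?] _; nra.
  have uz : C * ((z.2 : R) - dyadic j) `^ (alpha - b) <= u z.
    rewrite -lee_fin /u J_potential fineK; last first.
      by rewrite ge0_fin_numE// potential_ge0.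
    apply: (potential_ge_on_cell alpha b _ (c * dyadic j)) => //; first exact: ltW.
    by move=> w cw; rewrite /f (source_spot b c j).
  set S := (z.2 : R) - dyadic j in S0 Sc uz *.
  apply: (@le_trans _ _ ((C * S `^ (alpha - b)) `^ lambda)); last first.
    have CS0 : 0 <= C * S `^ (alpha - b) by rewrite mulr_ge0 ?powR_ge0// ltW.
    apply: ge0_ler_powR => //; rewrite ?nnegrE//; first exact: ltW.
    exact: le_trans uz.
  rewrite powRM ?powR_ge0 ?(ltW C0)// -powRrM.
  (* u^lambda >= C^lambda S^(-theta) S^(-b), and the first two factors
     multiply to at least 1 *)
  rewrite (_ : (alpha - b) * lambda = - theta - b); last by rewrite /theta; ring.
  rewrite powRD; last by rewrite (gt_eqF S0) implybT.
  rewrite mulrA ler_peMl ?powR_ge0//.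
  rewrite -ler_pdivrMl ?powR_gt0// mulr1; apply: (le_trans cA).
  rewrite !powRN lef_pV2 ?posrE ?powR_gt0//.
  by apply: ge0_ler_powR; rewrite ?nnegrE ?(ltW theta0) ?(ltW S0) ?(ltW c0).
have Yu : Yspace p alpha u by split => //; exists f => //; exact: ae_eq_refl.
exists u, f; split => //.
- by split => //; exact: ae_eq_refl.
- apply: nearW => z z0; rewrite /u J_potential potential_eq0// => w wz.
  by rewrite fneg// (lt_trans wz).
exists dyadic; split.
- by move=> j; rewrite dyadic_gt0 (le_lt_trans (dyadic_le_half j))// invf_lt1// ltr1n.
- exact: cvg_dyadic.
move=> j; have tj0 := dyadic_gt0 (R := R) j.
have spot_cyl : (spot c j : set (RnR R n)) `<=` cylinder (dyadic j).
  apply: cell_cylinder; first by rewrite mulr_gt0.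
  by rewrite mulrA ler_piMl// ltW.
have q0 : (0%:E < q)%E by apply: lt_trans hq; rewrite lte_fin.
have norm_oo (g : RnR R n -> R) : measurable_fun [set: RnR R n] g ->
    {ae lebesgue_RnR, forall z, f z <= g z} ->
    Lnorm_on (cylinder (dyadic j)) q g = +oo%E.
  move=> mg fg; apply: (Lnorm_on_cell_infinite _ _ _ _ _ b _ mg spot_cyl) => //.
  - exact: measurable_cylinder.
  - exact: mulr_gt0.
  - apply: filterS fg => z + cz; apply: le_trans.
    by rewrite /f (source_spot b c j).
split; apply: norm_oo => //.
- exact: (measurableT_comp (measurable_powR _)).
- by apply: filterS fle => z /andP[].
- exact: nearW.
Qed.
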